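(* Let $\overrightarrow{G}$ be an oriented graph with order $n$, and let $r\geq 1$ be an integer. If $$|E(\overrightarrow{G})|\geq\left(1-\frac{1}{t}\right)\frac{n^2}{2}$$ for some real number $t>0$, then $$N_r(\overrightarrow{G})\geq \binom{t}{r}\left(\frac{n}{t}\right)^r,$$ where $\binom{t}{r}=\frac{t(t-1)\cdots(t-r+1)}{r!}$ if $t>r-1$, and $\binom{t}{r}=0$ if $t\leq r-1$.
   Context: An oriented graph is a (finite) digraph without loops, without parallel arcs and without directed cycles of length two. Its order is its number of vertices, and $E(\overrightarrow{G})$ is its set of arcs. An $r$-tournament is a tournament on $r$ vertices, i.e. an oriented graph on $r$ vertices in which every two distinct vertices are joined by exactly one arc. $N_r(\overrightarrow{G})$ is the number of $r$-tournaments contained in $\overrightarrow{G}$, i.e. the number of $r$-vertex subsets of $V(\overrightarrow{G})$ inducing a tournament (so $N_1(\overrightarrow{G})=n$ and $N_2(\overrightarrow{G})=|E(\overrightarrow{G})|$). *)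

(* Defs.v *)
From mathcomp Require Import all_boot all_order all_algebra reals.

Set Implicit Arguments.
Unset Strict Implicit.
Unset Printing Implicit Defensive.

Import Order.TTheory GRing.Theory Num.Theory.

(* Arcs form a relation, so parallel arcs are excluded by construction. *)
Record oriented_graph := OrientedGraph {
  vertex :> finType;
  is_arc : rel vertex;
  arc_loopless : irreflexive is_arc;
  arc_no_2cycle : forall x y, ~~ (is_arc x y && is_arc y x)
}.
Arguments is_arc {o}.

Definition graph_order (G : oriented_graph) : nat := #|G|.

Definition arcs (G : oriented_graph) : {set G * G} :=
  [set e : G * G | is_arc e.1 e.2].

Section Induced.
Variables (G : oriented_graph) (A : {set G}).

Definition induced_arc : rel {x : G | x \in A} :=
  fun x y => is_arc (val x) (val y).

Fact induced_loopless : irreflexive induced_arc.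
Proof. by move=> x; apply: arc_loopless. Qed.

Fact induced_no_2cycle x y : ~~ (induced_arc x y && induced_arc y x).
Proof. exact: arc_no_2cycle. Qed.

Definition induced : oriented_graph :=
  OrientedGraph induced_loopless induced_no_2cycle.
End Induced.

Definition tournament (r : nat) (G : oriented_graph) : bool :=
  (graph_order G == r) &&
  [forall x : G, forall y : G, (x != y) ==> (is_arc x y (+) is_arc y x)].

Definition num_tournaments (r : nat) (G : oriented_graph) : nat :=
  #|[set A : {set G} | tournament r (induced A)]|.

Local Open Scope ring_scope.

Definition gbinom (R : realType) (t : R) (r : nat) : R :=
  if r%:R - 1 < t then (\prod_(i < r) (t - i%:R)) / (r`!)%:R else 0.

(* Main.v *)
(* The underlying graph of an oriented graph turns tournaments into cliques.
   Let K_s be the number of s-cliques and d(A) the number of common neighbours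
   of A.  For an s-clique S, a vertex w extends S :\ v for every v in S when w
   is a common neighbour of S, and for at most one v otherwise, so the d(S :\ v)
   sum to at most n + (s - 1) d(S).  Summing over S and using Cauchy-Schwarz on
   the (s - 1)-cliques gives the Moon-Moser inequality
     s^2 K_s^2 <= K_(s-1) (n K_s + (s^2 - 1) K_(s+1)),
   from which K_(s+1) / K_s >= (t - s) n / ((s + 1) t) propagates by induction
   on s, starting from the hypothesis on the number of arcs; the theorem is the
   product of these ratios. *)
Require Import Defs.
From mathcomp Require Import all_boot all_order all_algebra reals.
From mathcomp Require Import ring.

Import Order.TTheory GRing.Theory Num.Theory.
Local Open Scope ring_scope.

Lemma eq_ler {R : numDomainType} {x y : R} : x = y -> x <= y.
Proof. by move->. Qed.

(** Cauchy-Schwarz against the constant 1: after doubling, both sides are double sums over [i] and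
    [j], compared termwise by 2xy <= x^2 + y^2. *)
Lemma sqr_sum_leq (I : finType) (P : pred I) (a : I -> nat) :
  ((\sum_(i | P i) a i) ^ 2 <= #|P| * \sum_(i | P i) a i ^ 2)%N.
Proof.
have cst (c : nat) : (\sum_(i | P i) c = #|P| * c)%N by rewrite sum_nat_const.
rewrite -(leq_pmul2l (isT : 0 < 2)%N).
have -> : (2 * (\sum_(i | P i) a i) ^ 2 =
    \sum_(i | P i) \sum_(j | P j) 2 * (a i * a j))%N.
  rewrite -mulnn big_distrlr /= big_distrr /=.
  by apply: eq_bigr => i _; rewrite big_distrr.
have -> : (2 * (#|P| * \sum_(i | P i) a i ^ 2) =
    \sum_(i | P i) \sum_(j | P j) (a i ^ 2 + a j ^ 2))%N.
  under [RHS]eq_bigr do rewrite big_split /= cst.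
  by rewrite big_split /= cst -big_distrr /= mul2n addnn.
by apply: leq_sum => i _; apply: leq_sum => j _; apply: nat_Cauchy.
Qed.

(** * Counting cliques in a finite simple graph *)

Section Cliques.
Variables (T : finType) (e : rel T).
Hypotheses (e_irr : irreflexive e) (e_sym : symmetric e).

Definition clique (A : {set T}) : bool :=
  [forall x in A, forall y in A, (x != y) ==> e x y].

Definition kclique (k : nat) : pred {set T} :=
  [pred A | clique A & #|A| == k].

Definition common_nbrs (A : {set T}) : {set T} :=
  [set v | [forall x in A, e x v]].

Lemma cliqueP (A : {set T}) :
  reflect {in A &, forall x y, x != y -> e x y} (clique A).
Proof.
apply: (iffP forall_inP) => [h x y xA yA | h x xA].
  by move/forall_inP: (h x xA) => /(_ y yA)/implyP.
by apply/forall_inP => y yA; apply/implyP; apply: h.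
Qed.

Lemma common_nbrsP (A : {set T}) v :
  reflect {in A, forall x, e x v} (v \in common_nbrs A).
Proof. by rewrite inE; apply: forall_inP. Qed.

Lemma common_nbrs_notin (A : {set T}) v : v \in common_nbrs A -> v \notin A.
Proof. by move/common_nbrsP=> h; apply/negP => /h; rewrite e_irr. Qed.

Lemma clique_setU1 (A : {set T}) v : v \notin A ->
  clique (v |: A) = clique A && (v \in common_nbrs A).
Proof.
move=> vA; apply/cliqueP/andP => [h|[/cliqueP hA /common_nbrsP hv] x y].
  split; first by apply/cliqueP => x y xA yA; apply: h; rewrite inE ?xA ?yA orbT.
  apply/common_nbrsP => x xA; apply: h; rewrite ?inE ?eqxx ?xA ?orbT //.
  by apply: contraNneq vA => <-.
rewrite !inE => /predU1P[->|xA] /predU1P[->|yA]; rewrite ?eqxx //.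
- by rewrite e_sym hv.
- by rewrite hv.
- exact: hA.
Qed.

Lemma kclique_setU1 k (A : {set T}) v : v \notin A ->
  kclique k.+1 (v |: A) = kclique k A && (v \in common_nbrs A).
Proof. by move=> vA; rewrite /kclique /= clique_setU1 // cardsU1 vA eqSS andbAC. Qed.

(** Double counting: [(A, v)] and [(v |: A, v)] determine each other, since a common neighbour of
    [A] lies outside [A]. *)
Lemma sum_kclique_extend k (F : {set T} -> T -> nat) :
  (\sum_(A | kclique k A) \sum_(v in common_nbrs A) F A v =
   \sum_(B | kclique k.+1 B) \sum_(v in B) F (B :\ v) v)%N.
Proof.
rewrite !pair_big_dep /=.
rewrite (reindex_onto (fun p : {set T} * T => (p.1 :\ p.2, p.2))
                      (fun p : {set T} * T => (p.2 |: p.1, p.2))) /=; last first.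
  by case=> A v /= /andP[_ /common_nbrs_notin vA]; rewrite setU1K.
apply: eq_bigl => -[B v] /=; rewrite xpair_eqE eqxx andbT.
have [vB|vB] := boolP (v \in B).
  have := @kclique_setU1 k (B :\ v) v; rewrite /= setD11 setD1K // => -> //.
  by rewrite eqxx !andbT.
(* For [v] outside [B], adding [v] to [B :\ v] does not give back [B], so the reindexing discards
   this pair. *)
rewrite [X in _ && X](_ : _ = false) ?andbF //.
by apply: contraNF vB => /eqP <-; rewrite setU11.
Qed.

Lemma sum_common_nbrs k :
  (\sum_(A | kclique k A) #|common_nbrs A| = k.+1 * #|kclique k.+1|)%N.
Proof.
under eq_bigr do rewrite -sum1_card.
rewrite (sum_kclique_extend k (fun _ _ => 1%N)).
under eq_bigr => B /andP[_ /eqP cB] do rewrite sum1_card cB.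
by rewrite sum_nat_const mulnC.
Qed.

Lemma sum_common_nbrs_setD1 k (B : {set T}) : kclique k.+1 B ->
  (\sum_(v in B) #|common_nbrs (B :\ v)| <= #|T| + k * #|common_nbrs B|)%N.
Proof.
case/andP=> _ /eqP cB.
under eq_bigr do rewrite -sum1_card big_mkcond.
rewrite exchange_big /= -sum1_card mulnC -sum_nat_const.
rewrite [X in (_ <= _ + X)%N]big_mkcond -big_split /=.
apply: leq_sum => w _; rewrite -big_mkcondr sum1_card.
have [wB|/common_nbrsP/= hw] := boolP (w \in common_nbrs B).
  rewrite add1n -cB; apply: subset_leq_card.
  by apply/subsetP => v; rewrite unfold_in => /andP[].
(* A non-neighbour [x] of [w] stays in [B :\ v] unless [v = x], so [w] is counted at most once. *)
have [x xB nxw] : exists2 x, x \in B & ~~ e x w.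
  by apply/exists_inP; rewrite -negb_forall_in; apply/forall_inP.
rewrite addn0 -(card1 x); apply: subset_leq_card; apply/subsetP => v.
rewrite unfold_in => /andP[_ /common_nbrsP h]; rewrite inE.
by apply: contraNT nxw => vx; apply: h; rewrite !inE eq_sym vx xB.
Qed.

(** This is the Moon-Moser inequality for s = [k.+1]; the coefficient [k * k.+2] is s^2 - 1. *)
Lemma moon_moser k :
  (k.+1 ^ 2 * #|kclique k.+1| ^ 2 <= #|kclique k| *
     (#|T| * #|kclique k.+1| + k * (k.+2 * #|kclique k.+2|)))%N.
Proof.
rewrite -expnMn -sum_common_nbrs; apply: leq_trans (sqr_sum_leq _ _ _) _.
rewrite leq_mul2l; apply/orP; right.
(* Each square becomes a constant summed over the common neighbours of [A], the shape needed for
   double counting. *)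
under eq_bigr do rewrite -mulnn -sum_nat_const.
rewrite (sum_kclique_extend k (fun A _ => #|common_nbrs A|)).
rewrite -sum_common_nbrs big_distrr /= [X in (_ <= X + _)%N]mulnC -sum_nat_const.
by rewrite -big_split /=; apply: leq_sum => B; apply: sum_common_nbrs_setD1.
Qed.

Lemma card_kclique1 : #|kclique 1| = #|T|.
Proof.
rewrite -cardsT -(card_imset _ (@set1_inj T)); apply: eq_card => A.
apply/andP/imsetP => [[_ /cards1P[x ->]]|[x _ ->]]; first by exists x.
rewrite cards1; split=> //; apply/cliqueP => y z /set1P-> /set1P->.
by rewrite eqxx.
Qed.

(** Both sides are the sum of the degrees. *)
Lemma card_kclique2 : (2 * #|kclique 2| = #|[set p | e p.1 p.2]|)%N.
Proof.
rewrite -sum_common_nbrs.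
have -> : (\sum_(A | kclique 1 A) #|common_nbrs A| =
           \sum_(x : T) #|common_nbrs [set x]|)%N.
  rewrite -(big_imset (h := set1) (fun A => #|common_nbrs A|)) /=; last first.
    by move=> x y _ _; apply: set1_inj.
  apply: eq_bigl => A; apply/andP/imsetP => [[_ /cards1P[x ->]]|[x _ ->]].
    by exists x.
  rewrite cards1; split=> //; apply/cliqueP => y z /set1P-> /set1P->.
  by rewrite eqxx.
under eq_bigr do rewrite -sum1_card.
rewrite pair_big_dep /= sum1_card; apply: eq_card => -[x y].
rewrite [in RHS]inE unfold_in /=.
by apply/common_nbrsP/idP => [-> | exy z /set1P->]; rewrite ?set11.
Qed.

(** Positivity is carried through the induction because the step cancels a clique count. The base
    case is the edge hypothesis. *)
Lemma kclique_ratio (R : realFieldType) (t : R) (ht : 0 < t)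
    (hE : (1 - 1 / t) * (#|T|%:R ^+ 2 / 2) <= #|kclique 2|%:R)
    (hT : (0 < #|T|)%N) (s : nat) : s.+1%:R < t ->
  0 < #|kclique s.+1|%:R :> R /\
  (t - s.+1%:R) * #|T|%:R / (s.+2%:R * t) * #|kclique s.+1|%:R
    <= #|kclique s.+2|%:R.
Proof.
have n0 : 0 < #|T|%:R :> R by rewrite ltr0n.
elim: s => [|s IH] st.
  rewrite card_kclique1; split=> //; apply: le_trans hE.
  by apply: eq_ler; field; rewrite gt_eqF.
have st' : s.+1%:R < t by apply: lt_trans st; rewrite ltr_nat.
have [p0 pc] := IH st'.
have := moon_moser s.+1.
rewrite -(ler_nat R) !(natrM, natrD, natrX) => mm.
set a := #|kclique s.+1|%:R in p0 pc mm; set b := #|kclique s.+2|%:R in pc mm *.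
set c := #|kclique s.+3|%:R in mm *; set n := #|T|%:R in pc mm n0 *.
set q := (_ / _) in pc.
have q0 : 0 < q by rewrite divr_gt0 ?mulr_gt0 ?subr_gt0 // ltr0n.
have b0 : 0 < b by apply: lt_le_trans pc; apply: mulr_gt0.
split=> //.
set x := n * b + _ in mm.
have x0 : 0 <= x by rewrite addr_ge0 ?mulr_ge0 ?ler0n // ltW.
(* Multiply Moon-Moser by [q], replace [q * a] by the larger [b], and cancel one factor [b]. *)
have qx : s.+2%:R ^+ 2 * b * q <= x.
  rewrite -(ler_pM2l b0).
  have : q * (s.+2%:R ^+ 2 * b ^+ 2) <= q * (a * x) by rewrite ler_pM2l.
  have : q * a * x <= b * x by rewrite ler_wpM2r.
  move=> h1 h2; apply: le_trans (le_trans _ h2) (le_trans _ h1); apply: eq_ler; ring.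
(* The factor is the coefficient of [c] in [x]. What remains is (s+2)^2 q - n = (s+1)(t-s-2)n/t. *)
rewrite -(@ler_pM2l _ (s.+1%:R * s.+3%:R)) ?mulr_gt0 ?ltr0n //.
rewrite -lerBlDl in qx.
apply: le_trans (le_trans _ qx) _; apply: eq_ler; last by ring.
rewrite /q; field.
by rewrite gt_eqF //= -!natrD !pnatr_eq0.
Qed.

Lemma kclique_lower_bound (R : realFieldType) (t : R) (ht : 0 < t)
    (hE : (1 - 1 / t) * (#|T|%:R ^+ 2 / 2) <= #|kclique 2|%:R)
    (hT : (0 < #|T|)%N) (r : nat) : r%:R < t ->
  (\prod_(i < r.+1) (t - i%:R)) / (r.+1`!)%:R * (#|T|%:R / t) ^+ r.+1
    <= #|kclique r.+1|%:R.
Proof.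
elim: r => [|r IH] rt.
  rewrite big_ord1 card_kclique1 subr0 factS fact0 expr1 divr1.
  by apply: eq_ler; field; rewrite gt_eqF.
have rt' : r%:R < t by apply: lt_trans rt; rewrite ltr_nat.
have [_] := kclique_ratio _ _ ht hE hT _ rt; apply: le_trans.
set q := (_ / _ in leRHS).
have q0 : 0 <= q.
  by rewrite divr_ge0 ?mulr_ge0 ?subr_ge0 ?ler0n // ltW.
apply: le_trans (ler_wpM2l q0 (IH rt')).
(* The ratio [q] supplies exactly the new factor of the product, of the factorial and of the
   power. *)
rewrite big_ord_recr /= factS natrM exprS /q; apply: eq_ler; field.
by rewrite -natrD !pnatr_eq0 -lt0n fact_gt0 gt_eqF.
Qed.

End Cliques.

(** * Tournaments as cliques of the underlying graph *)

Definition adjacent (G : oriented_graph) : rel G :=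
  fun x y => is_arc x y || is_arc y x.

Lemma adjacent_irr (G : oriented_graph) : irreflexive (adjacent G).
Proof. by move=> x; rewrite /adjacent arc_loopless. Qed.

Lemma adjacent_sym (G : oriented_graph) : symmetric (adjacent G).
Proof. by move=> x y; rewrite /adjacent orbC. Qed.

(** Without 2-cycles, at least one arc means exactly one, as tournaments require. *)
Lemma adjacentE (G : oriented_graph) (x y : G) :
  adjacent G x y = is_arc x y (+) is_arc y x.
Proof.
by have := arc_no_2cycle x y; rewrite /adjacent; do 2!case: is_arc.
Qed.

Lemma num_tournamentsE (G : oriented_graph) r :
  num_tournaments r G = #|kclique G (adjacent G) r|.
Proof.
apply: eq_card => A; rewrite inE /tournament /graph_order card_sig andbC /=.
congr (_ && _); apply/forallP/cliqueP => [h x y xA yA xy | h x].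
  have /forallP/(_ (exist _ y yA))/implyP := h (exist _ x xA).
  by rewrite adjacentE; apply; rewrite -val_eqE.
apply/forallP => y; apply/implyP => xy; rewrite -adjacentE.
by apply: h; rewrite ?(valP x) ?(valP y).
Qed.

(** Adjacent ordered pairs are the arcs and their reversals, disjoint for lack of 2-cycles. *)
Lemma card_adjacent (G : oriented_graph) :
  #|[set p | adjacent G p.1 p.2]| = (2 * #|arcs G|)%N.
Proof.
pose swap (p : G * G) := (p.2, p.1).
have swap_inj : injective swap by move=> [x y] [u v] [-> ->].
have -> : [set p | adjacent G p.1 p.2] = arcs G :|: swap @: arcs G.
  apply/setP => -[x y]; rewrite !inE /= /adjacent; congr (_ || _).
  apply/idP/imsetP => [yx|[[u v]]]; first by exists (y, x); rewrite ?inE.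
  by rewrite inE /= => uv [-> ->].
rewrite cardsU (card_imset _ swap_inj) addnn -mul2n.
rewrite (_ : _ :&: _ = set0) ?cards0 ?subn0 //.
apply/setP => -[x y]; rewrite !inE /=; apply/negP => /andP[xy].
case/imsetP=> -[u v]; rewrite inE /= => uv [xv yu].
by have := arc_no_2cycle x y; rewrite xy xv yu uv.
Qed.

Theorem theorem1p10 (R : realType) (G : oriented_graph) (n r : nat) (t : R)
    (hn : graph_order G = n) (hr : (1 <= r)%N) (ht : 0 < t)
    (hE : (1 - 1 / t) * (n%:R ^+ 2 / 2) <= #|arcs G|%:R) :
  gbinom t r * (n%:R / t) ^+ r <= (num_tournaments r G)%:R.
Proof.
case: r hr => // r _; rewrite /gbinom -natr1 addrK num_tournamentsE.
case: ifP => [rt|_]; last by rewrite mul0r ler0n.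
(* The ratio argument needs a vertex; for [n = 0] the power vanishes, its exponent being
   positive. *)
have [n0|n_gt0] := posnP n.
  by rewrite n0 mul0r expr0n mulr0 ler0n.
have arcsE : #|kclique G (adjacent G) 2| = #|arcs G|.
  apply/eqP; rewrite -(eqn_pmul2l (isT : 0 < 2)%N).
  by rewrite card_kclique2 ?card_adjacent //; [apply: adjacent_irr | apply: adjacent_sym].
rewrite -hn /graph_order in hE n_gt0 *.
apply: kclique_lower_bound => //; rewrite ?arcsE //.
  exact: adjacent_irr.
exact: adjacent_sym.
Qed.
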